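(* Let $G$ be a permutation game. Then the limit game $H=\lim_{k\in\mathbb{N}}G^{2k}$ exists. Furthermore, $H$ is a permutation game. If $G$ is an involution game, then so is $H$.
   Context: $\mathbb{N}=\{1,2,3,\dots\}$, $\mathbb{N}_0=\{0,1,2,\dots\}$. An invariant subtraction game $G$ on $\mathbb{N}_0\times\mathbb{N}_0$ is given by a set of moves $\mathcal{M}(G)\subseteq(\mathbb{N}_0\times\mathbb{N}_0)\setminus\{(0,0)\}$; from position $(x,y)$ the options are all $(x-i,y-j)$ with $(i,j)\in\mathcal{M}(G)$, $i\le x$, $j\le y$. Two players alternate and a player who cannot move loses. A position is $P$ if all its options are $N$ (in particular if it has no options) and is $N$ if it has at least one $P$ option; $\mathcal{P}(G)$ is the set of $P$-positions. The game $G^\star$ is defined by $\mathcal{M}(G^\star)=\mathcal{P}(G)\setminus\{(0,0)\}$; $G^k$ denotes the game obtained from $G$ by $k$ successive applications of $\star$ (so $G^0=G$, $G^2=G^{\star\star}$). A permutation game is an invariant subtraction game such that each row and each column of $\mathbb{N}\times\mathbb{N}$ contains precisely one move, and no move has a zero coordinate. An involution game is a permutation game whose set of moves is symmetric, i.e. $(x,y)\in\mathcal{M}(G)$ if and only if $(y,x)\in\mathcal{M}(G)$. Convergence: for an invariant subtraction game $G$ and $n\in\mathbb{N}_0$ put $G_n=\mathcal{M}(G)\cap\{(x,y): x\le n\}$. A sequence $(G(k))_{k\in\mathbb{N}}$ of invariant subtraction games converges, with limit game $H=\lim_{k\in\mathbb{N}}G(k)$, if $H$ is an invariant subtraction game such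 that for all $n$ there is a $k$ with $H_n=G(i)_n$ for all $i>k$. *)

(* Defs.v *)
From mathcomp Require Import all_boot.
From mathcomp Require Import boolp classical_sets.

Set Implicit Arguments.
Unset Strict Implicit.
Unset Printing Implicit Defensive.

Local Open Scope classical_set_scope.
Local Open Scope nat_scope.

Record game := Game {
  moves : set (nat * nat);
  moves_neq0 : ~ moves (0, 0) }.

Definition is_option (G : game) (p q : nat * nat) : Prop :=
  exists i j, [/\ moves G (i, j), i <= p.1, j <= p.2 &
                  q = (p.1 - i, p.2 - j)].

(* The recursion is well founded since (0, 0) is not a move: every option has
   a smaller coordinate sum. Hence the least solution taken here is the only
   one; see [NposE]. *)
Inductive Ppos (G : game) : nat * nat -> Prop :=
| Ppos_intro p : (forall q, is_option G p q -> Npos G q) -> Ppos G p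
with Npos (G : game) : nat * nat -> Prop :=
| Npos_intro p q : is_option G p q -> Ppos G q -> Npos G p.

Lemma is_option_lt G p q : is_option G p q -> q.1 + q.2 < p.1 + p.2.
Proof.
case=> i [j [mij ip jp ->]] /=.
have ij_gt0 : 0 < i + j.
  rewrite lt0n; apply/negP; rewrite addn_eq0 => /andP[/eqP i0 /eqP j0].
  by apply: (@moves_neq0 G); rewrite i0 j0 in mij.
rewrite -(ltn_add2r (i + j)) addnACA !subnK//.
by rewrite -[X in X < _]addn0 ltn_add2l.
Qed.

Lemma NposE G p : Npos G p <-> ~ Ppos G p.
Proof.
have [m] := ubnP (p.1 + p.2); elim: m p => // m IH p; rewrite ltnS => pm.
have IHo q : is_option G p q -> Npos G q <-> ~ Ppos G q.
  by move=> pq; apply: IH; apply: leq_trans (is_option_lt pq) pm.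
split=> [Np Pp | nPp].
  case: Np Pp IHo => {pm}p q pq Pq Pp IHo.
  by case: Pp pq IHo => {}p H pq IHo; apply/(IHo q pq): Pq; apply: H.
apply: contrapT => nNp; apply: nPp; constructor=> q pq; apply/(IHo q pq) => Pq.
exact/nNp/(Npos_intro pq Pq).
Qed.

Lemma star_subproof (G : game) : ~ (Ppos G `\ (0, 0)) (0, 0).
Proof. by case=> _; apply. Qed.

Definition star (G : game) : game :=
  @Game (Ppos G `\ (0, 0)) (@star_subproof G).

Definition star_iter (k : nat) (G : game) : game := iter k star G.

Definition permutation_game (G : game) : Prop :=
  [/\ forall x, 0 < x -> exists! y, 0 < y /\ moves G (x, y),
      forall y, 0 < y -> exists! x, 0 < x /\ moves G (x, y) &
      forall x y, moves G (x, y) -> 0 < x /\ 0 < y].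

Definition involution_game (G : game) : Prop :=
  permutation_game G /\ forall x y, moves G (x, y) <-> moves G (y, x).

Definition truncation (G : game) (n : nat) : set (nat * nat) :=
  moves G `&` [set p | p.1 <= n].

(* Sequences are indexed by k >= 1 in the mathematics; the term of index 0 is never
   inspected, because i > k >= 0 below. *)
Definition is_limit_game (Gs : nat -> game) (H : game) : Prop :=
  forall n, exists k, forall i, k < i -> truncation H n = truncation (Gs i) n.

(* Main.v *)
Require Import Defs.
From mathcomp Require Import all_boot.
From mathcomp Require Import boolp classical_sets.
From mathcomp Require Import zify.

(** Let [F] be a game whose moves have no zero coordinate, write [F'] for
    [star F] and [F''] for [star (star F)].

    Every position on a coordinate axis is terminal in [F], so [F'] contains
    all Nim moves [(0, j)] and [(i, 0)].  Hence any row or column of [F'']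
    contains at most one move ([star2_row_uniq]), and none has a zero
    coordinate ([star2_positive]).

    Pointwise convergence holds for every game ([agree_star2]).  A nonzero
    position [p] is a move of [F'] iff it is not a move of [F] and is not
    blocked in [F], that is, no move other than [p] leads from [p] to a
    P-position.  Being blocked depends only on moves of smaller coordinate
    sum.  If [F] and [F''] have the same moves of smaller coordinate sum than
    [p], let [A] and [B] say that [p] is blocked in [F] and in [F'].  From [F]
    on, each double star sends the membership [e] of [p] to [(e \/ A) /\ ~ B],
    and this map is idempotent.  So the moves of coordinate sum [m] no longer
    change after [m + 1] double stars.

    This is not yet convergence, which is uniform on whole rows: the move in
    row [x] might escape to infinity.  It does not ([star2_row_step]).  If [F]
    has a move [(i, w)] and [w <= j], then [(i, j)] is an N-position of [F],
    since that move leads to the axis.  Let the rows strictly between 0 and [x]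
    of [F] and of [F''] all contain a move of height at most [B], and row [x]
    of [F] one of height at most [C], where [2 * B <= C].  If row [x] of [F'']
    had no move of height at most [C], then [(x, C)] would have an option
    [(x - i, C - j)] in [F'] that is a P-position.  Here [i = 0] is excluded by
    assumption, and if [0 < i < x], then [j < B] and [C - j <= B], whence
    [C < 2 * B], a contradiction.  The case [i = x] is similar, since [(0, 0)]
    is the only P-position of [F'] in row 0.  So one bound serves all iterates
    at once ([row_bound]), rows converge, and each row of the limit contains a
    move.  Columns, and the symmetry of the limit of an involution game, follow
    because the star commutes with transposition. *)

Set Implicit Arguments.
Unset Strict Implicit.
Unset Printing Implicit Defensive.

Local Open Scope nat_scope.

(** * P-positions and the star operator *)

Lemma PposP (G : game) p :
  Ppos G p <-> forall q, is_option G p q -> ~ Ppos G q.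
Proof.
split=> [[{}p H] q /H /NposE // | H].
by constructor=> q /H /NposE.
Qed.

Lemma Ppos00 (G : game) : Ppos G (0, 0).
Proof.
apply/PposP => q [i [j [mij /=]]]; rewrite !leqn0 => /eqP i0 /eqP j0.
by case: (@moves_neq0 G); rewrite i0 j0 in mij.
Qed.

Lemma moves_starE (G : game) p : moves (star G) p <-> Ppos G p /\ p <> (0, 0).
Proof. by []. Qed.

Lemma Ppos_star (G : game) p : Ppos G p <-> p = (0, 0) \/ moves (star G) p.
Proof.
split=> [Pp | [-> | []] //]; last exact: Ppos00.
by have [-> | p0] := EM (p = (0, 0)); [left | right].
Qed.

Lemma star_iter2S k (G : game) :
  star_iter (2 * k.+1) G = star (star (star_iter (2 * k) G)).
Proof. by rewrite mulnS. Qed.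

Lemma game_eqP (F G : game) : (forall p, moves F p <-> moves G p) -> F = G.
Proof.
case: F G => [F F0] [G G0] /= FG.
have E : F = G by apply/predeqP.
by case: _ / E G0 {FG} => G0; congr Game; apply: Prop_irrelevance.
Qed.

(** * Pointwise stabilization of the double star *)

(** The games [F] and [G] have the same moves of coordinate sum below [m]. *)
Definition agree m (F G : game) : Prop :=
  forall p, p.1 + p.2 < m -> moves F p <-> moves G p.

(** Some move other than [p] itself leads from [p] to a P-position. *)
Definition blocked (G : game) (p : nat * nat) : Prop :=
  exists i j, [/\ moves G (i, j), i <= p.1, j <= p.2, (i, j) <> p &
                  Ppos G (p.1 - i, p.2 - j)].

Lemma moves_star_blocked (G : game) p : p <> (0, 0) ->
  moves (star G) p <-> ~ moves G p /\ ~ blocked G p.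
Proof.
move=> p0; split=> [[/PposP Pp _] | [mp bp]].
  split=> [mp | [i [j [mij ip jp _ Pq]]]].
    apply: (Pp (0, 0)); last exact: Ppos00.
    exists p.1, p.2; rewrite !subnn; split=> //.
    by rewrite -surjective_pairing.
  by apply: (Pp (p.1 - i, p.2 - j)); first by exists i, j.
apply/moves_starE; split=> //; apply/PposP => q [i [j [mij ip jp ->]]] Pq.
by apply: bp; exists i, j; split=> // ijp; rewrite ijp in mij.
Qed.

Lemma agree_sym m (F G : game) : agree m F G -> agree m G F.
Proof. by move=> FG p pm; split=> /(FG p pm). Qed.

Lemma agree_trans m (F G H : game) : agree m F G -> agree m G H -> agree m F H.
Proof. by move=> FG GH p pm; rewrite (FG p pm); apply: GH. Qed.

Lemma agree_Ppos m (F G : game) : agree m F G ->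
  forall p, p.1 + p.2 < m -> Ppos F p <-> Ppos G p.
Proof.
move=> + p; have [n] := ubnP (p.1 + p.2).
elim: n p F G => // n IH p F G pn FG pm.
have half F' G' : agree m F' G' -> Ppos F' p -> Ppos G' p.
  move=> FG' /PposP Pp; apply/PposP => q pq.
  have qp := is_option_lt pq.
  case: (pq) => i [j [mij ip jp eq]].
  rewrite -(IH q F' G') //; [|lia|lia].
  by apply: Pp; exists i, j; split=> //; apply/FG' => //=; lia.
by split; apply: half => //; apply: agree_sym.
Qed.

Lemma agree_star m (F G : game) : agree m F G -> agree m (star F) (star G).
Proof. by move=> FG p pm; rewrite !moves_starE (agree_Ppos FG pm). Qed.

Lemma agree_blocked m (F G : game) p : agree m F G -> p.1 + p.2 = m ->
  blocked F p <-> blocked G p.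
Proof.
have half F' G' : agree m F' G' -> p.1 + p.2 = m -> blocked F' p -> blocked G' p.
  move=> FG pm [i [j [mij ip jp ijp Pq]]].
  have pq : is_option F' p (p.1 - i, p.2 - j) by exists i, j.
  have qp := is_option_lt pq; rewrite /= in qp.
  exists i, j; split=> //; last by apply/(agree_Ppos FG) => //=; lia.
  apply/FG => //=; case: (p) ijp ip jp pm => a b /= ijp ip jp pm.
  have : ~ (i = a /\ j = b) by case=> ia jb; rewrite ia jb in ijp.
  lia.
by move=> FG pm; split; apply: half => //; apply: agree_sym.
Qed.

(** The membership of a position of sum [m] follows the idempotent map
    [e |-> (e \/ A) /\ ~ B], so it is settled one double star later. *)
Lemma agree_star2 m (F : game) : agree m F (star (star F)) ->
  agree m.+1 (star (star F)) (star (star (star (star F)))).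
Proof.
move=> FF p; rewrite ltnS leq_eqVlt => /orP[/eqP pm | pm]; last first.
  exact: (agree_star (agree_star FF)).
have [-> | p0] := EM (p = (0, 0)); first by split=> /moves_neq0.
have bA := agree_blocked FF pm.
have bB := agree_blocked (agree_star FF) pm.
have e1 := moves_star_blocked F p0.
have e2 := moves_star_blocked (star F) p0.
have e3 := moves_star_blocked (star (star F)) p0.
have e4 := moves_star_blocked (star (star (star F))) p0.
have := EM (moves F p); have := EM (blocked F p); have := EM (blocked (star F) p).
tauto.
Qed.

Lemma agree_iter m k (G : game) : m <= k ->
  agree m (star_iter (2 * k) G) (star_iter (2 * k.+1) G).
Proof.
elim: m k => [|m IH] [|k] //; rewrite ltnS => mk; rewrite !star_iter2S.
by apply: agree_star2; rewrite -star_iter2S; apply: IH.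
Qed.

Lemma agree_iter_ge m k (G : game) : m <= k ->
  agree m (star_iter (2 * m) G) (star_iter (2 * k) G).
Proof.
elim: k => [|k IH]; first by rewrite leqn0 => /eqP->.
rewrite leq_eqVlt => /orP[/eqP-> // | mk].
exact: agree_trans (IH mk) (agree_iter _ _).
Qed.

(** The pointwise limit of the even iterates.  Membership of [p] is settled once
    the number of double stars exceeds the coordinate sum of [p]. *)
Definition limit_moves (G : game) (p : nat * nat) : Prop :=
  moves (star_iter (2 * (p.1 + p.2).+1) G) p.

Lemma limit_moves_neq0 (G : game) : ~ limit_moves G (0, 0).
Proof. exact: moves_neq0. Qed.

Definition limit_game (G : game) : game := Game (@limit_moves_neq0 G).

Lemma moves_limit (G : game) k p : p.1 + p.2 < k ->
  moves (limit_game G) p <-> moves (star_iter (2 * k) G) p.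
Proof. by move=> pk; apply: (agree_iter_ge G pk). Qed.

(** * Rows of the double star *)

(** No move has a zero coordinate. *)
Definition positive_moves (G : game) : Prop :=
  forall x y, moves G (x, y) -> 0 < x /\ 0 < y.

(** If no move has a zero coordinate, then the axes consist of terminal
    positions, so the star contains all Nim moves. *)
Lemma nim_moves_star (G : game) i j : positive_moves G ->
  i = 0 \/ j = 0 -> 0 < i + j -> moves (star G) (i, j).
Proof.
move=> Gp ij0 ij; apply/moves_starE; split; last by case=> i0 j0; lia.
apply/PposP => q [a [b [/Gp[a0 b0] /= ai bj _]]]; exfalso; lia.
Qed.

Lemma star2_positive (G : game) :
  positive_moves G -> positive_moves (star (star G)).
Proof.
move=> Gp x y [/PposP Pxy xy0].
have xy_gt0 : 0 < x + y.
  rewrite lt0n addn_eq0; apply/negP => /andP[/eqP x0 /eqP y0].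
  by apply: xy0; rewrite x0 y0.
have noNim : ~ (x = 0 \/ y = 0).
  move=> nim; apply: (Pxy (0, 0)); last exact: Ppos00.
  by exists x, y; rewrite !subnn; split=> //; apply: nim_moves_star.
lia.
Qed.

Lemma star2_row_uniq (G : game) x y z : positive_moves G ->
  moves (star (star G)) (x, y) -> moves (star (star G)) (x, z) -> y = z.
Proof.
move=> Gp; wlog yz : y z / y < z.
  by move=> W my mz; have [/W->|/W->|] := ltngtP y z.
move=> [Py _] [/PposP Pz _]; case: (Pz (x, y)) => //.
exists 0, (z - y); split=> /=; [|lia|lia|congr pair; lia].
by apply: nim_moves_star; [|left|lia].
Qed.

(** Every row strictly between 0 and [x] contains a move of height at most
    [B]. *)
Definition rows_bounded (G : game) (x B : nat) : Prop :=
  forall a, 0 < a -> a < x -> exists2 w, w <= B & moves G (a, w).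

(** The move [(i, w)] leads from every position of row [i] of height at least
    [w] to the axis. *)
Lemma Ppos_row_lt (G : game) i j w : positive_moves G ->
  Ppos G (i, j) -> moves G (i, w) -> j < w.
Proof.
move=> Gp /PposP Pij mw; rewrite ltnNge; apply/negP => wj.
apply: (Pij (0, j - w)); first by exists i, w; rewrite subnn.
by apply/PposP => q [a [b [/Gp[a0 _] /= aE _ _]]]; exfalso; lia.
Qed.

(** The height bound [C] of row [x] is the same before and after the double
    star, so it can be iterated. *)
Lemma star2_row_step (F : game) x B C w : positive_moves F -> 0 < x ->
  rows_bounded F x B -> rows_bounded (star (star F)) x B ->
  moves F (x, w) -> w <= C -> 2 * B <= C ->
  exists2 y, y <= C & moves (star (star F)) (x, y).
Proof.
move=> Fp x0 FB F2B mw wC BC; apply: contrapT => none.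
have xn0 c : (x, c) <> (0, 0) by case=> xE; lia.
have : ~ Ppos (star F) (x, C) by move=> P; apply: none; exists C => //; apply: (conj P (xn0 C)).
move=> /PposP; apply=> q [i [j [mij /= ix jC ->]]] Pq.
have [Pij ij0] := mij.
have [i0 | i_gt0] := posnP i.
  apply: none; exists (C - j); first lia.
  by apply/moves_starE; split=> //; rewrite -[x]subn0 -i0.
have [ixE | ix'] := eqVneq i x.
  (* The option lies in row 0, where (0, 0) is the only P-position of [star F]. *)
  move: Pq => /Ppos_star[[_ jC0] | /(star2_positive Fp)[]]; last by lia.
  by rewrite ixE in Pij; have := Ppos_row_lt Fp Pij mw; lia.
have [v vB mv] := FB i i_gt0 ltac:(lia).
have jv := Ppos_row_lt Fp Pij mv.
move: Pq => /Ppos_star[[]| mq]; first lia.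
have [u uB mu] := F2B (x - i) ltac:(lia) ltac:(lia).
have := star2_row_uniq Fp mq mu; lia.
Qed.

Lemma iter_positive (G : game) k :
  positive_moves G -> positive_moves (star_iter (2 * k) G).
Proof.
by move=> Gp; elim: k => [//|k IH]; rewrite star_iter2S; apply: star2_positive.
Qed.

Lemma iter_row_uniq (G : game) k x y z : positive_moves G -> 0 < k ->
  moves (star_iter (2 * k) G) (x, y) ->
  moves (star_iter (2 * k) G) (x, z) -> y = z.
Proof.
case: k => // k Gp _; rewrite star_iter2S.
exact/star2_row_uniq/iter_positive.
Qed.

Lemma row_bound (G : game) x : positive_moves G ->
  (forall a, 0 < a -> exists w, moves G (a, w)) ->
  exists B, forall k, rows_bounded (star_iter (2 * k) G) x B.
Proof.
move=> Gp Gr; elim: x => [|x [B IH]]; first by exists 0 => k a _.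
have [x0 | x_gt0] := posnP x; first by exists 0 => k a; rewrite x0; lia.
have [w mw] := Gr x x_gt0.
have wC : w <= maxn w (2 * B) by lia.
have BC : 2 * B <= maxn w (2 * B) by lia.
move: (maxn w _) wC BC => C wC BC.
have row k : exists2 y, y <= C & moves (star_iter (2 * k) G) (x, y).
  elim: k => [|k [y yC my]]; first by exists w.
  have B2 := IH k.+1; rewrite star_iter2S in B2; rewrite star_iter2S.
  exact: star2_row_step (iter_positive Gp) x_gt0 (IH k) B2 my yC BC.
exists C => k a a0; rewrite ltnS leq_eqVlt => /orP[/eqP-> // | ax].
by have [y yB my] := IH k a a0 ax; exists y => //; lia.
Qed.

Lemma limit_positive (G : game) :
  positive_moves G -> positive_moves (limit_game G).
Proof. by move=> Gp x y; apply: iter_positive. Qed.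

Lemma limit_row (G : game) x : positive_moves G ->
  (forall a, 0 < a -> exists w, moves G (a, w)) -> 0 < x ->
  exists! y, 0 < y /\ moves (limit_game G) (x, y).
Proof.
move=> Gp Gr x0; have [B HB] := row_bound x.+1 Gp Gr.
have [y yB my] := HB (x + B).+1 x x0 (ltnSn x).
have mH : moves (limit_game G) (x, y).
  by apply/(@moves_limit _ (x + B).+1) => //=; lia.
exists y; split=> [|z [_ mz]]; first by have [_ ->] := limit_positive Gp mH.
apply: (@iter_row_uniq G (x + y + z).+1 x) => //.
  by apply/moves_limit => //=; lia.
by apply/moves_limit => //=; lia.
Qed.

Lemma limit_game_is_limit (G : game) : positive_moves G ->
  (forall a, 0 < a -> exists w, moves G (a, w)) ->
  is_limit_game (fun k => star_iter (2 * k) G) (limit_game G).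
Proof.
move=> Gp Gr n; have [B HB] := row_bound n.+1 Gp Gr.
(* In rows up to n all moves of the iterates have height at most B. *)
have low k x y : 0 < k -> x <= n -> moves (star_iter (2 * k) G) (x, y) -> y <= B.
  move=> k0 xn my; have [x0 _] := iter_positive Gp my.
  by have [w wB mw] := HB k x x0 xn; rewrite (iter_row_uniq Gp k0 my mw).
exists (n + B) => i iB; apply/predeqP => -[x y].
split=> -[my /= xn]; split=> //.
  have yB := low (x + y).+1 x y isT xn my.
  by rewrite -(@moves_limit G i (x, y)) //=; lia.
have yB := low i x y (leq_ltn_trans (leq0n _) iB) xn my.
by rewrite (@moves_limit G i (x, y)) //=; lia.
Qed.

(** * Transposition *)

Lemma transpose_subproof (G : game) : ~ moves G (0, 0).
Proof. exact: moves_neq0. Qed.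

(** The game with the two coordinates exchanged. *)
Definition transpose (G : game) : game :=
  @Game (fun p => moves G (p.2, p.1)) (@transpose_subproof G).

Lemma transposeK (G : game) : transpose (transpose G) = G.
Proof. by apply: game_eqP => -[x y]. Qed.

Lemma Ppos_transpose (G : game) x y : Ppos (transpose G) (x, y) <-> Ppos G (y, x).
Proof.
have [m] := ubnP (x + y); elim: m x y G => // m IH x y G xym.
have half F a b : a + b <= m -> Ppos (transpose F) (a, b) -> Ppos F (b, a).
  move=> abm /PposP P; apply/PposP => q baq.
  have := is_option_lt baq; case: baq => i [j [mij /= ib ja ->]] /= lt.
  rewrite -IH; last lia.
  by apply: P; exists j, i.
split=> H; apply: half => //; first by rewrite addnC.
by rewrite transposeK.
Qed.

Lemma star_transpose (G : game) : star (transpose G) = transpose (star G).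
Proof.
apply: game_eqP => -[x y]; rewrite moves_starE Ppos_transpose.
by split=> -[P ne]; split=> // -[x0 y0]; apply: ne; rewrite x0 y0.
Qed.

Lemma star_iter_transpose k (G : game) :
  star_iter k (transpose G) = transpose (star_iter k G).
Proof. by elim: k => //= k ->; rewrite star_transpose. Qed.

Lemma limit_transpose (G : game) : limit_game (transpose G) = transpose (limit_game G).
Proof.
apply: game_eqP => -[x y] /=.
by rewrite /limit_moves star_iter_transpose /= addnC.
Qed.

Lemma limit_permutation (G : game) :
  permutation_game G -> permutation_game (limit_game G).
Proof.
case=> rows cols Gp; split=> [x x0|y y0|]; last exact: limit_positive.
  by apply: limit_row => // a /rows[w [[_ mw] _]]; exists w.
suff : exists! x, 0 < x /\ moves (limit_game (transpose G)) (y, x).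
  by rewrite limit_transpose.
apply: limit_row => // [a b /Gp[] //|a /cols[w [[_ mw] _]]].
by exists w.
Qed.

Theorem theorem4 (G : game) (hG : permutation_game G) :
  exists H : game,
    [/\ is_limit_game (fun k => star_iter (2 * k)%N G) H,
        permutation_game H &
        involution_game G -> involution_game H].
Proof.
have [rows _ Gp] := hG; exists (limit_game G); split.
- by apply: limit_game_is_limit => // a /rows[w [[_ mw] _]]; exists w.
- exact: limit_permutation.
- case=> _ sG; split; first exact: limit_permutation.
  have GT : transpose G = G by apply: game_eqP => -[a b]; apply: sG.
  by move=> x y; rewrite -{1}GT limit_transpose.
Qed.
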